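(* Let $M=(m_{ij})_{i,j=1,\dots,n}$ be a stochastic matrix whose reaction graph is connected and which is detailed balanced with respect to its invariant measure $w>0$. Let $t$ be any (undirected, spanning) tree in the undirected reaction graph of $M$, and define $w^t=(w^t_k)_{k=1,\dots,n}$ by $$w^t_k=\prod_{e_{ij}\in t_k} m_{ij},$$ where $t_k$ is the directed tree obtained by orienting every edge of $t$ towards $k$. Then $w^t$ is, up to normalization, the invariant measure of $M$, i.e. $w^t=c\,w$ for some constant $c>0$. Moreover, different trees only correspond to different normalization factors: for any two trees $t_1,t_2$ in the undirected reaction graph of $M$, the vectors $w^{t_1}$ and $w^{t_2}$ are positive multiples of each other.
   Context: A stochastic matrix is a real square matrix $M$ with non-negative entries all of whose rows sum to 1. An invariant measure of $M$ is a probability vector $w$ (non-negative entries summing to 1) with $w^TM=w^T$; $w>0$ means that all entries are positive. $M$ is detailed balanced with respect to its invariant measure $w$ if it is weakly reversible, i.e. $m_{ij}\neq 0$ implies $m_{ji}\neq 0$, and $m_{ij}w_i=m_{ji}w_j$ for all $i,j$. The undirected reaction graph of $M$ has vertex set $\{1,\dots,n\}$ and an undirected edge between distinct $i$ and $j$ whenever $m_{ij}\neq 0$ (equivalently $m_{ji}\ne 0$). A tree in an undirected graph $(V,E)$ is a subgraph $t=(V,E')$, $E'\subseteq E$, containing all vertices of $V$, connected, and without loops (cycles), i.e. a spanning tree. Given a tree $t$ and a vertex $k$, $t_k$ denotes the directed tree rooted at $k$ obtained from $t$ by orienting each edge in the direction of $k$; $e_{ij}$ denotes the directed edge from $i$ to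 $j$. An empty product equals 1. *)

(* Defs.v *)
From HB Require Import structures.
From mathcomp Require Import all_boot all_order all_algebra.
Set Implicit Arguments.
Unset Strict Implicit.
Unset Printing Implicit Defensive.
Import Order.TTheory GRing.Theory Num.Theory.
Local Open Scope ring_scope.

Definition stochastic (R : realFieldType) (n : nat) (M : 'M[R]_n) : Prop :=
  (forall i j, 0 <= M i j) /\ (forall i, \sum_j M i j = 1).

Definition probability_vector (R : realFieldType) (n : nat) (w : 'cV[R]_n) :
    Prop :=
  (forall i, 0 <= w i 0) /\ \sum_i w i 0 = 1.

Definition invariant_measure (R : realFieldType) (n : nat) (M : 'M[R]_n)
    (w : 'cV[R]_n) : Prop :=
  probability_vector w /\ w^T *m M = w^T.

Definition weakly_reversible (R : realFieldType) (n : nat) (M : 'M[R]_n) :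
    Prop :=
  forall i j, M i j != 0 -> M j i != 0.

Definition detailed_balanced (R : realFieldType) (n : nat) (M : 'M[R]_n)
    (w : 'cV[R]_n) : Prop :=
  weakly_reversible M /\ (forall i j, M i j * w i 0 = M j i * w j 0).

(* Undirected simple graphs are adjacency relations.  The relation below is
   symmetric exactly when M is weakly reversible. *)
Definition reaction_graph (R : realFieldType) (n : nat) (M : 'M[R]_n) :
    rel 'I_n :=
  fun i j => (i != j) && (M i j != 0).

Definition graph_connected (T : finType) (e : rel T) : Prop :=
  forall x y, connect e x y.

(* Cycles of length at most 2 are excluded: in a symmetric relation every edge
   yields a closed walk of length 2. *)
Definition graph_acyclic (T : finType) (e : rel T) : Prop :=
  forall c : seq T, (2 < size c)%N -> uniq c -> ~~ cycle e c.

Definition spanning_tree (T : finType) (e t : rel T) : Prop :=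
  [/\ symmetric t, irreflexive t, subrel t e, graph_connected t
    & graph_acyclic t].

(* i -> j is an arc of t rooted at k when {i, j} is the first edge of the simple
   path of t from i to k.  The length bound only serves to make this boolean;
   see rooted_arcP. *)
Definition rooted_arc (n : nat) (t : rel 'I_n) (k i j : 'I_n) : bool :=
  [exists m : 'I_n, exists p : m.-tuple 'I_n,
    [&& path t i (j :: p), uniq [:: i, j & p] & last j p == k]].

Lemma rooted_arcP (n : nat) (t : rel 'I_n) (k i j : 'I_n) :
  reflect (exists p : seq 'I_n,
             [/\ path t i (j :: p), uniq [:: i, j & p] & last j p = k])
          (rooted_arc t k i j).
Proof.
apply: (iffP existsP) => [[m /existsP [p /and3P [Hp Hu /eqP Hl]]]|].
  by exists (tval p).
case=> p [Hp Hu Hl].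
have Hs : (size p < n)%N.
  have := max_card (mem [:: i, j & p]).
  by rewrite (card_uniqP Hu) card_ord /= => /ltnW.
exists (Ordinal Hs); apply/existsP; exists (in_tuple p).
by apply/and3P; split=> //; apply/eqP.
Qed.

Definition rooted_tree (n : nat) (t : rel 'I_n) (k : 'I_n) :
    {set 'I_n * 'I_n} :=
  [set e | rooted_arc t k e.1 e.2].

Definition tree_measure (R : realFieldType) (n : nat) (M : 'M[R]_n)
    (t : rel 'I_n) : 'cV[R]_n :=
  \col_k \prod_(e in rooted_tree t k) M e.1 e.2.

(* Main.v *)
Require Import Defs.
From HB Require Import structures.
From mathcomp Require Import all_boot all_order all_algebra.
Set Implicit Arguments.
Unset Strict Implicit.
Unset Printing Implicit Defensive.
Import Order.TTheory GRing.Theory Num.Theory.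
Local Open Scope ring_scope.

(** Move the root of the tree [t] along one of its edges, from [a] to a
neighbour [b].  Every edge other than {a, b} has both its endpoints on the same
side of {a, b}, so it points towards [a] exactly when it points towards [b]: the
move only replaces the arc b -> a by a -> b ([rooted_tree_move_root]).  The
products over the two rooted trees thus share a factor [D], with
[w^t_a = m_ba * D] and [w^t_b = m_ab * D], and detailed balance
[m_ab * w_a = m_ba * w_b] gives [w^t_a * w_b = w^t_b * w_a]
([tree_measure_edge]).

Hence the ratio [w^t_k / w_k] takes the same value at the two ends of each edge
of [t], and as [t] is connected it is a constant.  It is positive because
arcs of [t] are reactions of [M], whose entries are positive.  Two trees are
compared through [w]. *)

Lemma rooted_arc_edge n (t : rel 'I_n) k i j : rooted_arc t k i j -> t i j.
Proof. by case/rooted_arcP=> p [/= /andP[]]. Qed.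

Lemma rooted_arc_root n (t : rel 'I_n) k j : ~~ rooted_arc t k k j.
Proof.
apply/rooted_arcP=> -[p [_ /= /andP[k_notin _] last_k]].
by rewrite -{1}last_k mem_last in k_notin.
Qed.

Lemma rooted_arc_to_root n (t : rel 'I_n) a b :
  irreflexive t -> t b a -> rooted_arc t a b a.
Proof.
move=> t_irr tba; apply/rooted_arcP; exists [::].
rewrite /= tba inE !andbT; split=> //.
by apply/eqP=> eq_ba; rewrite eq_ba t_irr in tba.
Qed.

(** A simple path from [i] to [a] yields one to the neighbour [b] with the same
first edge: cut it at [b] if it visits [b] after its start, extend it by [b] if
it avoids [b].  If it starts at [b], then it is the single edge b -> a, since
a longer one would close up with {a, b} into a cycle. *)
Lemma rooted_arc_move_root n (t : rel 'I_n) a b i j :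
  graph_acyclic t -> t a b -> (i, j) != (b, a) ->
  rooted_arc t a i j -> rooted_arc t b i j.
Proof.
move=> t_acyclic tab neq_ij /rooted_arcP[p [path_p uniq_p last_p]].
have [eq_ib|neq_ib] := eqVneq i b.
  subst i; case: p => [|x p] in path_p uniq_p last_p *.
    by rewrite /= in last_p; rewrite last_p eqxx in neq_ij.
  have /negP[] := @t_acyclic [:: b, j, x & p] isT uniq_p.
  by move: last_p; rewrite (cycle_path b) /= => ->; rewrite tab.
apply/rooted_arcP; have [b_in|b_notin] := boolP (b \in j :: p); last first.
  exists (rcons p b); split; last by rewrite last_rcons.
    by rewrite -rcons_cons rcons_path path_p /= last_p.
  rewrite -!rcons_cons rcons_uniq uniq_p andbT.
  by rewrite in_cons eq_sym (negPf neq_ib).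
have [p' [p2 [def_p last_p']]] :
    exists p', exists p2, p = p' ++ p2 /\ last j p' = b.
  move: b_in; rewrite inE => /orP[/eqP->|]; first by exists [::], p.
  by case/path.splitP=> p1 p2; exists (rcons p1 b), p2; rewrite last_rcons.
exists p'; split=> //; move: path_p uniq_p; rewrite def_p -!cat_cons.
  by rewrite cat_path => /andP[].
by rewrite cat_uniq => _ /andP[].
Qed.

Lemma rooted_tree_move_root n (t : rel 'I_n) a b :
  symmetric t -> irreflexive t -> graph_acyclic t -> t a b ->
  rooted_tree t b = (a, b) |: (rooted_tree t a :\ (b, a)).
Proof.
move=> t_sym t_irr t_acyclic tab; have tba : t b a by rewrite t_sym.
apply/setP=> -[i j]; rewrite !inE /=.
have [[-> ->]|neq_ab] := eqVneq (i, j) (a, b); first exact: rooted_arc_to_root.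
have [[-> ->]|neq_ba] /= := eqVneq (i, j) (b, a).
  exact/negbTE/rooted_arc_root.
by apply/idP/idP; apply: rooted_arc_move_root.
Qed.

Lemma tree_measure_edge (R : realFieldType) n (M : 'M[R]_n) (w : 'cV[R]_n)
    (t : rel 'I_n) a b :
  detailed_balanced M w -> spanning_tree (reaction_graph M) t -> t a b ->
  tree_measure M t a 0 * w b 0 = tree_measure M t b 0 * w a 0.
Proof.
move=> [_ balance] [t_sym t_irr _ _ t_acyclic] tab.
have tba : t b a by rewrite t_sym.
rewrite !mxE (rooted_tree_move_root t_sym t_irr t_acyclic tab).
rewrite big_setU1 /=; last by rewrite !inE (negPf (rooted_arc_root _ _ _)) andbF.
rewrite (big_setD1 (b, a)) /=; last by rewrite inE rooted_arc_to_root.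
by rewrite mulrAC -balance mulrAC.
Qed.

Lemma tree_measure_gt0 (R : realFieldType) n (M : 'M[R]_n) (t : rel 'I_n) k :
  (forall i j, 0 <= M i j) -> subrel t (reaction_graph M) ->
  0 < tree_measure M t k 0.
Proof.
move=> M_ge0 t_sub; rewrite mxE; apply: prodr_gt0 => -[i j].
rewrite inE => /rooted_arc_edge/t_sub/andP[_ M_neq0].
by rewrite lt_def M_neq0 M_ge0.
Qed.

Lemma connected_constant (T : finType) (S : eqType) (e : rel T) (f : T -> S) :
  graph_connected e -> (forall x y, e x y -> f x = f y) ->
  forall x y, f x = f y.
Proof.
move=> e_conn f_edge x y; have /connectP[p path_p ->] := e_conn x y.
by elim: p x path_p => //= z p IHp x /andP[/f_edge-> /IHp].
Qed.

Lemma tree_measure_proportional (R : realFieldType) n (M : 'M[R]_n)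
    (w : 'cV[R]_n) (t : rel 'I_n) :
  (forall i j, 0 <= M i j) -> (forall i, 0 < w i 0) ->
  detailed_balanced M w -> spanning_tree (reaction_graph M) t ->
  exists2 c : R, 0 < c & tree_measure M t = c *: w.
Proof.
move=> M_ge0 w_gt0 balance t_tree; have [_ _ t_sub t_conn _] := t_tree.
have [k _|no_vertex] := pickP 'I_n; last first.
  by exists 1; first exact: ltr01; apply/colP=> i; have := no_vertex i.
have w_neq0 j : w j 0 != 0 by rewrite gt_eqF.
exists (tree_measure M t k 0 / w k 0); first by rewrite divr_gt0 ?tree_measure_gt0.
apply/colP=> i; rewrite [RHS]mxE.
have ratio := connected_constant (f := fun x => tree_measure M t x 0 / w x 0).
rewrite (ratio t t_conn _ k i) ?divfK // => a b tab; apply/eqP.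
by rewrite eqr_div // (tree_measure_edge balance t_tree tab).
Qed.

Theorem theorem7p4 (R : realFieldType) (n : nat) (M : 'M[R]_n) (w : 'cV[R]_n)
    (hM : stochastic M)
    (hconn : graph_connected (reaction_graph M))
    (hw : invariant_measure M w)
    (hw_gt0 : forall i : 'I_n, 0 < w i 0)
    (hdb : detailed_balanced M w) :
  (forall t : rel 'I_n, spanning_tree (reaction_graph M) t ->
     exists2 c : R, 0 < c & tree_measure M t = c *: w)
  /\
  (forall t1 t2 : rel 'I_n,
     spanning_tree (reaction_graph M) t1 ->
     spanning_tree (reaction_graph M) t2 ->
     exists2 c : R, 0 < c & tree_measure M t1 = c *: tree_measure M t2).
Proof.
have [M_ge0 _] := hM.
have proportional t := @tree_measure_proportional R n M w t M_ge0 hw_gt0 hdb.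
split=> // t1 t2 /proportional[c1 c1_gt0 ->] /proportional[c2 c2_gt0 ->].
exists (c1 / c2); first exact: divr_gt0.
by rewrite scalerA divfK ?gt_eqF.
Qed.
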